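(* For every prime number $p$, every finite Abelian $p$-group is perspective.
   Context: An Abelian group $G$ is called perspective if any two isomorphic direct summands of $G$ have a common direct complement: whenever $G=A\oplus H=B\oplus K$ with $A\cong B$, there exists a subgroup $C\le G$ with $G=A\oplus C=B\oplus C$. *)

(* Defs.v *)
From mathcomp Require Import all_boot all_fingroup all_solvable.

Set Implicit Arguments.
Unset Strict Implicit.
Unset Printing Implicit Defensive.

Local Open Scope group_scope.

(* Groups are written multiplicatively: A \x H = G is the internal direct sum
   decomposition of G. Commutativity of G is not part of the predicate. *)
Definition perspective (gT : finGroupType) (G : {group gT}) : Prop :=
  forall A H B K : {group gT},
    A \x H = G -> B \x K = G -> A \isog B ->
    exists C : {group gT}, A \x C = G /\ B \x C = G.

(* Main.v *)
Require Import Defs.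
From mathcomp Require Import all_boot all_fingroup all_solvable.

Set Implicit Arguments.
Unset Strict Implicit.
Unset Printing Implicit Defensive.

Local Open Scope group_scope.

(** Finite abelian p-groups have the substitution property: if
    A \x H = B \x K = G with A isomorphic to B, then some C satisfies
    C \x H = C \x K = G. Here the summands are isomorphic and it is their
    complements that get a common complement. The property implies
    perspectivity when it is used twice. The first use gives H \isog G / C
    \isog K (cancellation of A against B); the second one, with H and K as the
    isomorphic summands and A and B as their complements, gives a common
    complement of A and B.

    Substitution itself is proved by splitting off cyclic factors from A
    ([substitution]). For cyclic A = <[a]> and B = <[b]> ([cycle_substitution])
    either A, B or <[a * b]> can be taken as C. Indeed, if A is not a complement
    of K then it meets K (the orders fit), so the unique minimal subgroup of A lies in K;
    likewise if B is not a complement of H then the minimal subgroup of B lies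
    in H. The minimal subgroup of <[a * b]> is generated by a product of
    generators of these two, which lies neither in H nor in K. If A is
    <[a]> \x A2, a cyclic common complement C of A2 \x H and B2 \x K is found
    first; in G / C the images of A2 and B2 are isomorphic summands with
    complements the images of H and K, and a common complement of the latter
    pulls back to G. *)

(** * Direct decompositions and quotients of abelian groups *)

Lemma dprod_TI_card (gT : finGroupType) (G A H : {group gT}) :
    abelian G -> A \subset G -> H \subset G -> A :&: H = 1 ->
  (#|A| * #|H|)%N = #|G| -> A \x H = G.
Proof.
move=> abG sAG sHG tiAH cardAH.
have cAH : H \subset 'C(A) by apply: sub_abelian_cent2 abG _ _.
rewrite dprodE //; apply/eqP.
by rewrite eqEcard mul_subG //= TI_cardMg // cardAH.
Qed.

Lemma quotient_TI_isog (gT : finGroupType) (G A C : {group gT}) :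
  abelian G -> A \subset G -> C \subset G -> C :&: A = 1 -> A \isog A / C.
Proof.
move=> abG sAG sCG tiCA; apply: quotient_isog => //.
exact: cents_norm (sub_abelian_cent2 abG _ _).
Qed.

(** The quotient by C restricts to an isomorphism from L onto G / C, which
    carries the decomposition of L over to G / C. *)
Lemma quotient_dprod (gT : finGroupType) (G L C A H : {group gT}) :
    abelian G -> C \x L = G -> A \x H = L ->
  [/\ A \isog A / C, C :&: H = 1 & (A / C) \x (H / C) = G / C].
Proof.
move=> abG defG defL.
have [_ defM cAH tiAH] := dprodP defL; have [_ defCL cCL tiCL] := dprodP defG.
have sCG : C \subset G by rewrite -defCL mulG_subl.
have sLG : L \subset G by rewrite -defCL mulG_subr.
have sAL : A \subset L by rewrite -defM mulG_subl.
have sHL : H \subset L by rewrite -defM mulG_subr.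
have sAG := subset_trans sAL sLG; have sHG := subset_trans sHL sLG.
have tiCA : C :&: A = 1 by apply/trivgP; rewrite -tiCL setIS.
have tiCH : C :&: H = 1 by apply/trivgP; rewrite -tiCL setIS.
have isoA := quotient_TI_isog abG sAG sCG tiCA.
have isoH := quotient_TI_isog abG sHG sCG tiCH.
have isoL := quotient_TI_isog abG sLG sCG tiCL.
have defGC : L / C = G / C by rewrite -defCL quotientMidl.
split=> //; have nCA : A \subset 'N(C).
  exact: cents_norm (sub_abelian_cent2 abG _ _).
have mulAH : (A / C) * (H / C) = G / C by rewrite -defGC -defM quotientMl.
rewrite dprodE // ?quotient_cents //; apply: cardMg_TI.
rewrite mulAH -defGC -(card_isog isoL) -(card_isog isoA) -(card_isog isoH).
by rewrite (dprod_card defL).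
Qed.

(** Since C meets H trivially, H is isomorphic to H / C, so a complement of
    H / C in G / C, pulled back to G, still meets H trivially and has the right
    order. *)
Lemma cosetpre_dprod (gT : finGroupType) (G C H : {group gT})
    (D : {group coset_of C}) :
    abelian G -> C \subset G -> H \subset G -> C :&: H = 1 ->
  D \x (H / C) = G / C -> (coset C @*^-1 D) \x H = G.
Proof.
move=> abG sCG sHG tiCH defGC; have [_ defDH _ tiDH] := dprodP defGC.
have nCG : G \subset 'N(C).
  exact: cents_norm (sub_abelian_cent2 abG _ _).
have nCH := subset_trans sHG nCG.
have nsCG : C <| G by rewrite -(sub_abelian_normal C abG).
have isoH := quotient_TI_isog abG sHG sCG tiCH.
apply: dprod_TI_card => //.
- rewrite -(quotientGK nsCG) morphpreS //.
  by rewrite -defDH mulG_subl.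
- apply/trivgP/subsetP=> x /setIP[/morphpreP[nCx Dx] Hx]; rewrite -tiCH inE Hx.
  rewrite andbT; apply: coset_idr => //; apply/set1P.
  by rewrite -[[set 1]]tiDH inE Dx mem_quotient.
rewrite card_cosetpre -mulnA (card_isog isoH) (dprod_card defGC).
by rewrite card_quotient // Lagrange.
Qed.

(** * Cyclic summands *)

(** The power of x here generates the unique minimal subgroup of <[x]>. *)
Lemma cycle_TI (gT : finGroupType) (p : nat) (x : gT) (K : {group gT}) :
    prime p -> p.-elt x -> x ^+ (p ^ (logn p #[x] - 1)) \notin K ->
  <[x]> :&: K = 1.
Proof.
move=> pr_p px Kx; rewrite setIC; apply: TI_Ohm1; rewrite setIC.
apply: prime_TIg; last by rewrite /= (Ohm_p_cycle 1 px) cycle_subG.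
rewrite (Ohm1_cyclic_pgroup_prime (cycle_cyclic x) px) //.
by apply: contraNneq Kx => /eqP; rewrite cycle_eq1 => /eqP->; rewrite expg1n.
Qed.

(** The common complement is found among the cycles of a, b and a * b. All three
    elements are tested on the same power m, chosen so that a ^+ m and b ^+ m
    have order p: a cycle of order #[a] meets a subgroup nontrivially only if
    the m-th power of its generator lies in that subgroup. *)
Lemma cycle_substitution (gT : finGroupType) (p : nat) (a b : gT)
    (G H K : {group gT}) :
    prime p -> abelian G -> p.-group G ->
    <[a]> \x H = G -> <[b]> \x K = G -> #[a] = #[b] ->
  exists c, <[c]> \x H = G /\ <[c]> \x K = G.
Proof.
move=> pr_p abG pG defGa defGb oab.
have [a1|nt_a] := eqVneq a 1.
  have b1 : b = 1 by apply/eqP; rewrite -order_eq1 -oab a1 order1.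
  by exists 1; move: defGa defGb; rewrite a1 b1.
have [_ defaH _ tiaH] := dprodP defGa; have [_ defbK _ tibK] := dprodP defGb.
have Ga : a \in G by rewrite -cycle_subG -defaH mulG_subl.
have Gb : b \in G by rewrite -cycle_subG -defbK mulG_subl.
have sHG : H \subset G by rewrite -defaH mulG_subr.
have sKG : K \subset G by rewrite -defbK mulG_subr.
have cardH : (#[a] * #|H|)%N = #|G| := dprod_card defGa.
have cardK : (#[a] * #|K|)%N = #|G| by rewrite oab; apply: dprod_card defGb.
have pa := mem_p_elt pG Ga; have pb := mem_p_elt pG Gb.
have dprod_cycle c (L : {group gT}) :
    c \in G -> L \subset G -> #[c] = #[a] -> (#[a] * #|L|)%N = #|G| ->
  c ^+ (p ^ (logn p #[a] - 1)) \notin L -> <[c]> \x L = G.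
- move=> Gc sLG oc cardL Lc; apply: dprod_TI_card; rewrite ?cycle_subG //.
    by apply: (@cycle_TI _ p) => //; [apply: mem_p_elt Gc | rewrite oc].
  by rewrite -orderE oc.
have [k oa] := p_natP pa.
have k_gt0 : 0 < k by case: k oa nt_a => // /eqP; rewrite order_eq1 => ->.
move: dprod_cycle; rewrite oa pfactorK // subn1; set m := (p ^ k.-1)%N.
have oam : #[a ^+ m] = p.
  by rewrite (orderXexp _ oa) -subn1 subKn // expn1.
have obm : #[b ^+ m] = p.
  by rewrite (orderXexp _ (etrans (esym oab) oa)) -subn1 subKn // expn1.
have Ham : a ^+ m \notin H.
  apply/negP=> Ham; have : a ^+ m \in <[a]> :&: H by rewrite inE mem_cycle.
  by rewrite tiaH => /set1P a1; rewrite a1 order1 in oam; rewrite -oam in pr_p.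
have Kbm : b ^+ m \notin K.
  apply/negP=> Kbm; have : b ^+ m \in <[b]> :&: K by rewrite inE mem_cycle.
  by rewrite tibK => /set1P b1; rewrite b1 order1 in obm; rewrite -obm in pr_p.
move=> dprod_cycle; rewrite -oa in dprod_cycle.
have [Kam|Kam] := boolP (a ^+ m \in K); last first.
  by exists a; split=> //; apply: dprod_cycle.
have [Hbm|Hbm] := boolP (b ^+ m \in H); last first.
  by exists b; split=> //; apply: dprod_cycle.
(* Of the two factors of (a * b) ^+ m, exactly one lies in H, and exactly one
   in K, so the product lies in neither. *)
have cab : commute a b by apply: (centsP abG).
have abmH : (a * b) ^+ m \notin H by rewrite expgMn // groupMr.
have abmK : (a * b) ^+ m \notin K by rewrite expgMn // groupMl.
have abm : #[(a * b) ^+ m] = p.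
  apply: nt_prime_order => //; first by rewrite -expgM expgMn // !expgM -{1}oam
    -obm !expg_order mulg1.
  by apply: contraNneq abmH => ->.
have oc : #[a * b] = #[a].
  by rewrite (orderXpfactor abm pr_p (dvdnn p)) oa -expnSr prednK.
by exists (a * b); split; apply: dprod_cycle; rewrite ?groupM.
Qed.

(** * Substitution *)

(** An element whose order is the exponent of A generates a direct factor. *)
Lemma abelian_split_cycle (gT : finGroupType) (A : {group gT}) :
    abelian A -> A :!=: 1 ->
  exists (x : gT) (A2 : {group gT}), x != 1 /\ <[x]> \x A2 = A.
Proof.
move=> abA ntA.
have [x Ax ox] := exponent_witness (abelian_nil abA).
have /splitsP[A2 /complP[tiA2 defA2]] := abelian_splits Ax (esym ox) abA.
exists x, A2; split.
  by apply: contraNneq ntA => x1; rewrite trivg_exponent ox x1 order1.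
rewrite dprodE //; apply: sub_abelian_cent2 abA _ _; rewrite -defA2.
  exact: mulG_subr.
exact: mulG_subl.
Qed.

(** Induction on the order of A: after removing one cyclic factor from A and B
    and replacing it by a common cyclic C, the remaining factors of A and B stay
    isomorphic in G / C. *)
Lemma substitution (p : nat) (gT : finGroupType) (G A H B K : {group gT}) :
    prime p -> abelian G -> p.-group G ->
    A \x H = G -> B \x K = G -> A \isog B ->
  exists C : {group gT}, C \x H = G /\ C \x K = G.
Proof.
move=> pr_p; have [n] := ubnP #|A|.
elim: n gT => // n IHn gT in G A H B K * => /ltnSE-leAn abG pG defGA defGB isoAB.
have [A1|ntA] := eqVneq (A : {set gT}) 1.
  exists 1%G; have B1 : B :=: 1.
    by apply: card1_trivg; rewrite -(card_isog isoAB) A1 cards1.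
  by move: defGA defGB; rewrite A1 B1.
have abA : abelian A.
  by apply: abelianS abG; case/dprodP: defGA => _ <- _ _; apply: mulG_subl.
have [a [A2 [nt_a defA]]] := abelian_split_cycle abA ntA.
have [f injf fA] := isogP isoAB.
have [_ /= mulA _ _] := dprodP defA.
have Aa : a \in A by rewrite -cycle_subG -mulA mulG_subl.
have sA2A : A2 \subset A by rewrite -mulA mulG_subr.
have defB : <[f a]> \x (f @* A2) = B.
  by rewrite -morphim_cycle // -fA; apply: injm_dprod defA.
have isoAB2 : A2 \isog f @* A2 := sub_isog sA2A injf.
rewrite -defA -dprodA in defGA; rewrite -defB -dprodA in defGB.
have [[_ L _ defL] _ _ _] := dprodP defGA; rewrite defL in defGA.
have [[_ M _ defM] _ _ _] := dprodP defGB; rewrite defM in defGB.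
have [|c [defGcL defGcM]] := cycle_substitution pr_p abG pG defGA defGB.
  by rewrite (order_injm injf).
have [isoA2 tiCH defGcA] := quotient_dprod abG defGcL defL.
have [isoB2 tiCK defGcB] := quotient_dprod abG defGcM defM.
have [|||| D [defDH defDK]] := IHn _ _ _ _ _ _ _ _ _ defGcA defGcB.
- rewrite -(card_isog isoA2); apply: leq_trans leAn.
  by rewrite -(dprod_card defA) ltn_Pmull // order_gt1.
- exact: quotient_abelian.
- exact: quotient_pgroup.
- by rewrite -(isog_transl _ isoA2) (isog_transl _ isoAB2).
have sCG : <[c]> \subset G by case/dprodP: defGcL => _ <- _ _; apply: mulG_subl.
have sHG : H \subset G.
  case/dprodP: defGA => _ <- _ _; apply: subset_trans (mulG_subr _ _).
  by case/dprodP: defL => _ <- _ _; apply: mulG_subr.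
have sKG : K \subset G.
  case/dprodP: defGB => _ <- _ _; apply: subset_trans (mulG_subr _ _).
  by case/dprodP: defM => _ <- _ _; apply: mulG_subr.
by exists (coset <[c]> @*^-1 D)%G; split; apply: cosetpre_dprod.
Qed.

Theorem proposition3p8 (p : nat) (gT : finGroupType) (G : {group gT}) :
  prime p -> abelian G -> p.-group G -> perspective G.
Proof.
move=> pr_p abG pG A H B K defGA defGB isoAB.
have [C [defCH defCK]] := substitution pr_p abG pG defGA defGB isoAB.
have isoHK : H \isog K.
  have isoH := sdprod_isog (dprodWsd defCH).
  by rewrite (isog_transl _ isoH) isog_sym (sdprod_isog (dprodWsd defCK)).
rewrite dprodC in defGA; rewrite dprodC in defGB.
have [D [defDA defDB]] := substitution pr_p abG pG defGA defGB isoHK.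
by exists D; rewrite ![_ \x D]dprodC.
Qed.
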